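(* Let $(R,M)$ be a finite commutative local ring with identity, of characteristic $p^n$ ($p$ a prime). If $M-\{0\}$ is a connected subset of $\Gamma_{\mathrm{Aut}\,R}(R)$, then $R$ is isomorphic to $\mathbb{Z}_4$ or to $\mathbb{F}_q[X_1,\ldots,X_m]/I$ for some finite field $\mathbb{F}_q$ with $q$ elements and some integer $m\ge 0$, where $I$ is the ideal generated by the elements $X_iX_j$ with $1\le i,j\le m$ (for $m=0$ this ring is, by convention, $\mathbb{F}_q$).
   Context: All rings are commutative with identity; $\mathbb{Z}_n$ is the ring of integers modulo $n$; $(R,M)$ denotes a local ring with maximal ideal $M$. $\mathrm{Aut}\,R$ is the group of ring automorphisms of $R$. The graph $\Gamma_{\mathrm{Aut}\,R}(R)$ is the simple graph whose vertices are the elements of $R$, where two distinct vertices $x,y$ are adjacent if and only if there is $\sigma\in\mathrm{Aut}\,R$ with $\sigma(x)=y$. A subset $S\subset R$ is connected in this graph if any two distinct elements of $S$ are joined by a path; equivalently, for all $a,b\in S$ there is $\sigma\in\mathrm{Aut}\,R$ with $\sigma(a)=b$. The empty set counts as connected. *)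

(* Defs.v *)
From HB Require Import structures.
From mathcomp Require Import all_boot all_order all_algebra.
From mathcomp Require Import ring_quotient boolp.
From mathcomp Require Import mpoly.

Set Implicit Arguments.
Unset Strict Implicit.
Unset Printing Implicit Defensive.

Import GRing.Theory.
Local Open Scope ring_scope.

Definition ring_iso (A B : nzRingType) : Prop :=
  exists f : {rmorphism A -> B}, bijective f.

(* [pchar R] only records prime characteristics, hence this definition. *)
Definition has_characteristic (R : nzRingType) (c : nat) : Prop :=
  forall k : nat, (k%:R == 0 :> R) = (c %| k)%N.

(* idealr_closed includes properness (1 \notin M). *)
Definition maximal_ideal (R : finComNzRingType) (M : {set R}) : Prop :=
  idealr_closed M /\
  forall N : {set R}, idealr_closed N -> M \subset N -> N = M.

Definition local_ring (R : finComNzRingType) (M : {set R}) : Prop :=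
  maximal_ideal M /\ forall N : {set R}, maximal_ideal N -> N = M.

Definition aut_graph (R : finComNzRingType) : rel R := fun x y =>
  (x != y) &&
  `[< exists sigma : {rmorphism R -> R}, bijective sigma /\ sigma x = y >].

(* Paths are taken in the whole graph; for this graph that is the same as
   requiring them to stay inside S, since each component is a clique. *)
Definition aut_connected (R : finComNzRingType) (S : {set R}) : Prop :=
  {in S &, forall x y : R, x != y -> connect (@aut_graph R) x y}.

Definition generated_ideal (A : comNzRingType) (J : finType) (g : J -> A)
  : {pred A} :=
  fun a => `[< exists c : J -> A, a = \sum_(j : J) c j * g j >].

Section QuadraticIdeal.
Variables (F : comNzRingType) (m : nat).

Definition quadratic_ideal : {pred {mpoly F[m]}} :=
  generated_ideal (fun ij : 'I_m * 'I_m => 'X_(ij.1) * 'X_(ij.2)).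

Fact quadratic_ideal_closed : idealr_closed quadratic_ideal.
Proof.
split.
- by apply/asboolP; exists (fun=> 0); rewrite big1 // => j _; rewrite mul0r.
- apply/asboolP => -[c /(congr1 (mcoeff 0%MM))].
  rewrite mcoeff1 eqxx raddf_sum /= big1 => [/eqP|j _]; first by rewrite oner_eq0.
  by rewrite !rmorphM /= mcoeffX mnm1_eq0 mul0r mulr0.
- move=> a u v /asboolP[c ->] /asboolP[d ->]; apply/asboolP.
  exists (fun j => a * c j + d j); rewrite mulr_sumr -big_split /=.
  by apply: eq_bigr => j _; rewrite mulrDl mulrA.
Qed.

HB.instance Definition _ :=
  isIdealr.Build {mpoly F[m]} quadratic_ideal quadratic_ideal_closed.

Definition quadratic_quotient : comNzRingType := {ideal_quot quadratic_ideal}.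

End QuadraticIdeal.

(* Main.v *)
(* An element s <> 0 of M with sM = 0 exists, and automorphisms preserve M, so
   transitivity on M - {0} gives M^2 = 0.  If p <> 0 in R, then p lies in M and
   is fixed by every automorphism, so M = {0, p}; hence p = 2 and R is Z_4.  If
   p = 0, then x |-> x^p kills M, and the power q = p^k for which x |-> x^q is
   idempotent makes F = {x | x^q = x} a field with R = F (+) M; evaluating
   polynomials over F at an F-basis of M has kernel generated by the X_i X_j. *)
Require Import Defs.
From HB Require Import structures.
From mathcomp Require Import all_boot all_order all_algebra.
From mathcomp Require Import ring_quotient boolp mpoly.

Set Implicit Arguments.
Unset Strict Implicit.
Unset Printing Implicit Defensive.

Import GRing.Theory.
Local Open Scope ring_scope.
Local Open Scope quotient_scope.

(** * Ring isomorphisms, and iteration on a finite set *)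

Lemma ring_iso_sym (A B : nzRingType) : ring_iso A B -> ring_iso B A.
Proof.
case=> f [g fK gK].
have f_inj := can_inj fK.
have gB : zmod_morphism g by move=> x y; apply: f_inj; rewrite rmorphB !gK.
have gM : monoid_morphism g.
  by split=> [|x y]; apply: f_inj; rewrite ?rmorph1 ?rmorphM !gK.
pose gg := HB.pack_for {rmorphism B -> A} g
  (GRing.isZmodMorphism.Build _ _ _ gB) (GRing.isMonoidMorphism.Build _ _ _ gM).
by exists gg; exists f.
Qed.

Lemma inj_surj_bij (A B : Type) (f : A -> B) :
  injective f -> (forall y, exists x, f x = y) -> bijective f.
Proof.
move=> f_inj /choice[g fK]; exists g => // x.
exact: f_inj.
Qed.

Lemma first_isomorphism (A : comNzRingType) (I : idealr A) (B : nzRingType)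
    (h : {rmorphism A -> B}) :
  (forall b, exists a, h a = b) -> (forall a, (a \in I) = (h a == 0)) ->
  ring_iso B {ideal_quot I}.
Proof.
move=> h_surj kerh; apply: ring_iso_sym.
(* Any representative would do: two of them differ by an element of [I], the kernel of [h]. This is
   what [gpi] records. *)
pose g (q : {ideal_quot I}) := h (repr q).
have gpi a : g (\pi a) = h a.
  apply/eqP; rewrite -subr_eq0 -rmorphB -kerh Quotient.idealrBE.
  by rewrite reprK.
have gB : zmod_morphism g.
  by elim/quotW=> x; elim/quotW=> y; rewrite -rmorphB !gpi rmorphB.
have gM : monoid_morphism g.
  split; first by rewrite -(rmorph1 (\pi_{ideal_quot I})) gpi rmorph1.
  by elim/quotW=> x; elim/quotW=> y; rewrite -rmorphM !gpi rmorphM.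
pose gg := HB.pack_for {rmorphism {ideal_quot I} -> B} g
  (GRing.isZmodMorphism.Build _ _ _ gB) (GRing.isMonoidMorphism.Build _ _ _ gM).
exists gg; apply: inj_surj_bij => [|b]; last first.
  by have [a <-] := h_surj b; exists (\pi a); apply: gpi.
elim/quotW=> x; elim/quotW=> y /eqP; rewrite /= !gpi -subr_eq0 -rmorphB -kerh.
by rewrite Quotient.idealrBE => /eqP.
Qed.

(** By pigeonhole two iterates of indices [i < j] coincide, so from index [i] on the iterates have
    period [j - i]. Any positive multiple of this period that is at least [i] can serve as [k]. The
    lemma is meant for the Frobenius map. *)
Lemma iter_idempotent (T : finType) (f : T -> T) :
  exists2 k, (0 < k)%N & forall x, iter k f (iter k f x) = iter k f x.
Proof.
pose F (i : 'I_(#|{ffun T -> T}|.+1)) := [ffun x => iter i f x].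
have /injectivePn[i [j neq_ij eqF]] : ~~ injectiveb F.
  apply/injectiveP => F_inj.
  by have := leq_card _ F_inj; rewrite card_ord ltnn.
wlog lt_ij : i j neq_ij eqF / (i < j)%N.
  move=> wl; move: (neq_ij); rewrite neq_ltn => /orP[]; first exact: wl.
  by apply: wl; rewrite 1?eq_sym.
have period m x : (i <= m)%N -> iter (m + (j - i)) f x = iter m f x.
  move=> le_im; have /ffunP/(_ x) := eqF; rewrite !ffunE => eqx.
  rewrite -(subnK le_im) -addnA subnKC ?(ltnW lt_ij) //.
  by rewrite !iterD eqx.
have periodM l m x : (i <= m)%N -> iter (m + (j - i) * l) f x = iter m f x.
  move=> le_im; elim: l => [|l IHl]; first by rewrite muln0 addn0.
  by rewrite mulnS addnCA addnC period ?(leq_trans le_im) ?leq_addr.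
(* The factor [i.+1], rather than [i], keeps the exponent positive when [i] is 0. *)
exists ((j - i) * i.+1)%N; first by rewrite muln_gt0 subn_gt0 lt_ij.
move=> x; rewrite -iterD periodM //.
by rewrite ltnW // leq_pmull // subn_gt0.
Qed.

(** * Finite local rings, and transitivity of automorphisms on M - {0} *)

Section LocalRing.

Variables (R : finComNzRingType) (M : {set R}).
Hypothesis locM : local_ring M.

(** If [x] has no inverse, the ideal [xR] is proper. A proper ideal of largest cardinality among
    those containing [xR] is maximal, hence equal to [M], so [x] lies in [M]. *)
Lemma local_unit x : x \notin M -> exists y, x * y = 1.
Proof.
move=> xNM; apply: contrapT => xNunit.
pose xR := [set x * r | r : R].
have xR_ideal : idealr_closed xR.
  split=> [||a u v /imsetP[r _ ->] /imsetP[t _ ->]].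
  - by apply/imsetP; exists 0; rewrite ?mulr0.
  - by apply/imsetP => -[y _ xy1]; apply: xNunit; exists y.
  - by apply/imsetP; exists (a * r + t); rewrite // mulrDr mulrCA.
pose P (N : {set R}) := `[< idealr_closed N >] && (xR \subset N).
have PxR : P xR by rewrite /P subxx andbT; apply/asboolP.
case: (arg_maxnP (fun N : {set R} => #|N|) PxR) => N /andP[/asboolP idN sxRN] maxN.
have maxiN : maximal_ideal N.
  split=> // N' idN' sNN'; apply/esym/eqP; rewrite eqEcard sNN' /=; apply: maxN.
  by apply/andP; split; [apply/asboolP | apply: subset_trans sNN'].
move/negP: xNM; apply; rewrite -(locM.2 N maxiN).
by apply: (subsetP sxRN); apply/imsetP; exists 1; rewrite ?mulr1.
Qed.

Let idM : idealr_closed M. Proof. exact: locM.1.1. Qed.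

Lemma maximal0 : 0 \in M. Proof. by case: idM. Qed.

Lemma maximalMl a x : x \in M -> a * x \in M.
Proof. by case: idM => M0 _ MD Mx; rewrite -[_ * _]addr0 MD. Qed.

Lemma maximalD x y : x \in M -> y \in M -> x + y \in M.
Proof. by case: idM => M0 _ MD Mx My; rewrite -[x]mul1r MD. Qed.

Lemma maximalB x y : x \in M -> y \in M -> x - y \in M.
Proof. by move=> Mx My; rewrite -[y]mul1r -mulNr maximalD ?maximalMl. Qed.

Lemma maximal_nonunit x y : x \in M -> x * y != 1.
Proof.
case: idM => _ M1 _ Mx; apply: contraNneq M1 => <-.
by rewrite mulrC maximalMl.
Qed.

Lemma subr1_unit x : x \in M -> exists y, (1 - x) * y = 1.
Proof.
move=> Mx; apply: local_unit; apply/negP => M1x.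
by have := maximal_nonunit 1 (maximalD M1x Mx); rewrite subrK mulr1 eqxx.
Qed.

Lemma nilpotent_maximal x k : x ^+ k = 0 -> x \in M.
Proof.
move=> xk0; apply/negPn/negP => /local_unit[y xy1].
by have /eqP := oner_neq0 R; case; rewrite -(expr1n _ k) -xy1 exprMn xk0 mul0r.
Qed.

(* A nonzero s in M with the principal ideal sR minimal: if s x != 0 with x in
   M then s = s x r, and 1 - x r is a unit. *)
Lemma maximal_socle :
  M :\ 0 != set0 -> exists2 s, s \in M :\ 0 & {in M, forall x, s * x = 0}.
Proof.
case/set0Pn=> s0 Ms0.
case: (arg_minnP (P := fun s => s \in M :\ 0) (fun s => #|[set s * r | r : R]|) Ms0).
move=> s Ms min_s.
exists s => // x Mx; apply/eqP/negPn/negP => sx0.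
have /min_s le_card : s * x \in M :\ 0 by rewrite !inE sx0 maximalMl.
have sub : [set s * x * r | r : R] \subset [set s * r | r : R].
  apply/subsetP=> _ /imsetP[r _ ->]; apply/imsetP; exists (x * r) => //.
  by rewrite mulrA.
have /eqP eq_sR : [set s * x * r | r : R] == [set s * r | r : R].
  by rewrite eqEcard sub.
have : s \in [set s * r | r : R] by apply/imsetP; exists 1; rewrite ?mulr1.
rewrite -eq_sR => /imsetP[r _ def_s].
have [|y y1] := @subr1_unit (x * r); first by rewrite mulrC maximalMl.
have s_eq0 : s = 0.
  by rewrite -[s]mulr1 -y1 mulrA mulrBr mulr1 mulrA -def_s subrr mul0r.
by move: Ms; rewrite s_eq0 !inE eqxx.
Qed.

Lemma connect_automorphism (x y : R) :
  connect (@aut_graph R) x y ->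
  exists sigma : {rmorphism R -> R}, bijective sigma /\ sigma x = y.
Proof.
case/connectP=> s; elim: s x => [|z s IHs] x /=.
  by move=> _ ->; exists idfun; split=> //; exists id.
case/andP=> /andP[_ /asboolP[sigma [bij_s sx]]] path_s /(IHs _ path_s).
case=> tau [bij_t tz]; exists (tau \o sigma); split; first exact: bij_comp.
by rewrite /= sx.
Qed.

Hypothesis connM : aut_connected (M :\ 0%R).

Lemma connected_automorphism x y : x \in M :\ 0 -> y \in M :\ 0 ->
  exists sigma : {rmorphism R -> R}, bijective sigma /\ sigma x = y.
Proof.
move=> Mx My; apply: connect_automorphism.
by have [->|] := eqVneq x y; [apply: connect0 | apply: connM].
Qed.

Lemma maximal_square0 : {in M &, forall x y, x * y = 0}.
Proof.
move=> x y Mx My; have [->|x0] := eqVneq x 0; first by rewrite mul0r.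
have M0x : x \in M :\ 0 by rewrite !inE x0.
have [|s M0s sM] := maximal_socle; first by apply/set0Pn; exists x.
have [sigma [[tau sK tK] <-]] := connected_automorphism M0s M0x.
(* Here [sigma s * y = sigma (s * tau y)], so it remains to see that [tau y] is in [M]: if it were a
   unit, so would be its image [y] under [sigma]. *)
rewrite -[y]tK -rmorphM sM ?rmorph0 //.
apply/negPn/negP => /local_unit[z yz1].
by have := maximal_nonunit (sigma z) My; rewrite -[y]tK -rmorphM yz1 rmorph1 eqxx.
Qed.

End LocalRing.

(** * The case p <> 0 in R: the ring Z_4 *)

Lemma Z4_of_nonzero_char (R : finComNzRingType) (M : {set R}) (p n : nat) :
    prime p -> has_characteristic R (p ^ n)%N -> local_ring M ->
    aut_connected (M :\ 0%R) -> p%:R != 0 :> R -> ring_iso R 'Z_4.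
Proof.
move=> pr_p charR locM connM p0.
have Mp : p%:R \in M.
  by apply: (@nilpotent_maximal _ _ locM _ n); apply/eqP; rewrite -natrX charR.
have M_eq x : x \in M -> x != 0 -> x = p%:R.
  move=> Mx x0.
  have [||sigma [_ <-]] := connected_automorphism connM (x := p%:R) (y := x).
  - by rewrite !inE p0.
  - by rewrite !inE x0.
  - by rewrite rmorph_nat.
have pp0 : p%:R * p%:R = 0 :> R by apply: (maximal_square0 locM connM).
(* The element -p is also nonzero and in [M], hence equal to p. *)
have p2 : p%:R + p%:R = 0 :> R.
  have := M_eq (- p%:R); rewrite oppr_eq0 -[- _]sub0r maximalB ?(maximal0 locM) //.
  by move=> /(_ isT p0) => E; rewrite -{1}E sub0r addNr.
have p_gt1 := prime_gt1 pr_p.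
(* From p^2 = 0 the exponent [n] is at most 2, and p <> 0 excludes [n <= 1]. Then 2p = 0 says that
   p^2 divides 2p, which forces p = 2. *)
have n2 : n = 2%N.
  move/eqP: pp0; rewrite -natrM charR mulnn dvdn_Pexp2l // => le_n2.
  move: p0; rewrite charR -{2}[p]expn1 dvdn_Pexp2l // -ltnNge => lt_1n.
  by apply/eqP; rewrite eqn_leq le_n2.
have p_eq2 : p = 2%N.
  move/eqP: p2; rewrite -natrD charR n2 addnn -mul2n expnS expn1.
  by rewrite dvdn_pmul2r ?prime_gt0 // dvdn_prime2 // => /eqP.
subst p n.
have char4 k : (k%:R == 0 :> R) = (4 %| k)%N by exact: charR.
have natr_mod k : (k %% 4)%:R = k%:R :> R.
  rewrite {2}(divn_eq k 4) natrD natrM; have /eqP -> : 4%:R == 0 :> R by rewrite char4.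
  by rewrite mulr0 add0r.
pose f (a : 'Z_4) : R := (a : nat)%:R.
have fD : {morph f : a b / a + b} by move=> a b; rewrite /f /= natr_mod natrD.
have fB : zmod_morphism f by move=> a b; apply: (addIr (f b)); rewrite -fD !subrK.
have fM : monoid_morphism f by split=> // a b; rewrite /f /= natr_mod natrM.
pose g := HB.pack_for {rmorphism 'Z_4 -> R} f
  (GRing.isZmodMorphism.Build _ _ _ fB) (GRing.isMonoidMorphism.Build _ _ _ fM).
apply: ring_iso_sym; exists g; apply: inj_surj_bij => [a b /eqP|x].
  rewrite -subr_eq0 -fB char4 => /eqP; rewrite modn_small ?ltn_ord // => ab0.
  by apply/eqP; rewrite -subr_eq0; apply/eqP/val_inj.
have M_surj y : y \in M -> exists a : 'Z_4, f a = y.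
  move=> My; have [->|/(M_eq y My) ->] := eqVneq y 0; first by exists 0.
  by exists 2%:R.
have [/M_surj //|xNM] := boolP (x \in M).
(* The residue field has two elements: for [x] outside [M], [2x] is a nonzero element of [M], so
   [2x = 2]. If [x - 1] had an inverse [y], then [2 = 2(x - 1)y = 0]. *)
have [a fa] : exists a : 'Z_4, f a = x - 1.
  apply: M_surj; apply/negPn/negP => /(local_unit locM)[y xy1].
  have x20 : 2%:R * x != 0.
    have [z xz1] := local_unit locM xNM.
    by apply: contraNneq p0 => x20; rewrite -[2%:R]mulr1 -[X in _ * X]xz1 mulrA x20 mul0r.
  have /M_eq/(_ x20) x2 : 2%:R * x \in M by rewrite mulrC (maximalMl locM).
  move/eqP: p0; apply.
  by rewrite -[2%:R]mulr1 -[X in _ * X]xy1 mulrA mulrBr mulr1 x2 subrr mul0r.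
by exists (a + 1); rewrite /= fD fa subrK.
Qed.

(** * The case p = 0 in R: a coefficient field from a power of Frobenius *)

Section FixedSubring.

Variables (R : finComNzRingType) (phi : {rmorphism R -> R}).

Definition fixed_points : {pred R} := fun x => phi x == x.

Fact fixed_points_subring : subring_closed fixed_points.
Proof.
split=> [|x y|x y]; rewrite !unfold_in ?rmorph1 //.
- by rewrite rmorphB => /eqP-> /eqP->.
- by rewrite rmorphM => /eqP-> /eqP->.
Qed.

HB.instance Definition _ :=
  GRing.isSubringClosed.Build R fixed_points fixed_points_subring.

Record fixed_subring := FixedSubring {
  fixed_val :> R;
  _ : fixed_val \in fixed_points
}.

HB.instance Definition _ := [isSub for fixed_val].
HB.instance Definition _ := [Finite of fixed_subring by <:].
HB.instance Definition _ := [SubChoice_isSubComNzRing of fixed_subring by <:].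

End FixedSubring.

Lemma finField_of_units (K : finComNzRingType) :
  (forall x : K, x != 0 -> exists y, x * y = 1) ->
  exists F : finFieldType, ring_iso F K.
Proof.
move=> unitK.
(* The value at 0 is prescribed as well, since a field structure requires the inverse of 0 to be
   0. *)
have /choice[inv invP] (x : K) :
    exists y, (x != 0 -> y * x = 1) /\ (x = 0 -> y = 0).
  have [->|x0] := eqVneq x 0; first by exists 0.
  have [y xy1] := unitK x x0; exists y; split=> [_|x_eq0]; first by rewrite mulrC.
  by rewrite x_eq0 eqxx in x0.
have mulVK x : x != 0 -> inv x * x = 1 by case: (invP x).
have inv0 : inv 0 = 0 by case: (invP 0) => _; apply.
pose F := HB.pack_for finFieldType K (GRing.ComNzRing_isField.Build K mulVK inv0).
by exists F; exists idfun; exists id.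
Qed.

(** The field is the ring of fixed points of an idempotent power [phi] of Frobenius. As [phi] kills
    [M], a nonzero fixed point lies outside [M] and is a unit. Each [x] is congruent modulo [M] to
    the fixed point [phi x]. *)
Lemma coefficient_field (R : finComNzRingType) (M : {set R}) (p : nat) :
    local_ring M -> {in M &, forall x y, x * y = 0} -> p \in [pchar R] ->
  exists (F : finFieldType) (iota : {rmorphism F -> R}),
    forall x, exists a, x - iota a \in M.
Proof.
move=> locM MM0 charR; have pr_p := pcharf_prime charR.
have [k k_gt0 idk] := iter_idempotent (fun x : R => x ^+ p).
have iterE i (x : R) : iter i (fun x : R => x ^+ p) x = x ^+ (p ^ i).
  by elim: i => [|i IHi] //=; rewrite IHi -exprM expnSr.
pose q := (p ^ k)%N.
have qid (x : R) : x ^+ q ^+ q = x ^+ q by have := idk x; rewrite !iterE.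
(* With [q] at least 2, [x ^+ q] contains the factor [x * x], which vanishes on [M]. *)
have q_gt1 : (1 < q)%N by rewrite -[1%N]/(p ^ 0)%N ltn_exp2l ?prime_gt1.
have pq : [pchar R].-nat q.
  by rewrite pnatX (eq_pnat _ (pcharf_eq charR)) pnat_id.
have qB : zmod_morphism (fun x : R => x ^+ q).
  by move=> x y; rewrite exprDn_pchar ?exprNn_pchar.
have qM : monoid_morphism (fun x : R => x ^+ q).
  by split=> [|x y]; rewrite ?expr1n ?exprMn.
pose phi := HB.pack_for {rmorphism R -> R} (fun x : R => x ^+ q)
  (GRing.isZmodMorphism.Build _ _ _ qB) (GRing.isMonoidMorphism.Build _ _ _ qM).
have phi_maximal x : x \in M -> phi x = 0.
  by move=> Mx; rewrite /= -(subnKC q_gt1) exprD expr2 (MM0 x x) // mul0r.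
have [|F [iota [iota' iotaK iota'K]]] := @finField_of_units (fixed_subring phi).
  move=> x x0; have [|y xy1] := local_unit locM (x := fixed_val x).
    apply: contraNN x0 => /phi_maximal phix0; apply/eqP/val_inj.
    by apply: etrans phix0; apply/esym/eqP/(valP x).
  (* Applying [phi] to [x * y = 1] shows that [phi y] is another inverse of the fixed point [x];
     inverses are unique. *)
  have fix_y : y \in fixed_points phi.
    have := congr1 phi xy1; rewrite rmorphM rmorph1 (eqP (valP x)) => xpy1.
    by apply/eqP; rewrite -[LHS]mul1r -xy1 mulrAC xpy1 mul1r.
  by exists (FixedSubring fix_y); apply: val_inj.
exists F; exists (val \o iota) => x.
have fix_x : phi x \in fixed_points phi by apply/eqP; apply: qid.
exists (iota' (FixedSubring fix_x)); rewrite /= iota'K /=.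
(* By idempotence, (x - x^q)^q = x^q - x^(q^2) = 0. *)
apply: (@nilpotent_maximal _ _ locM _ q).
by have /= -> := qB x (x ^+ q); rewrite qid subrr.
Qed.

(** * A basis of M over the coefficient field *)

Lemma spanning_basis (F : fieldType) (R : finComNzRingType)
    (iota : {rmorphism F -> R}) (M : {set R}) :
  exists (m : nat) (e : 'I_m -> R),
    [/\ forall i, e i \in M,
        {in M, forall x, exists c, x = \sum_i iota (c i) * e i}
      & forall c, \sum_i iota (c i) * e i = 0 -> forall i, c i = 0].
Proof.
(* A spanning family of least size is free, since a nontrivial relation would allow one member to be
   dropped. The enumeration of all of [M] shows that finite spanning families exist. *)
pose spans m := `[< exists e : 'I_m -> R, (forall i, e i \in M) /\
  {in M, forall x, exists c, x = \sum_i iota (c i) * e i} >].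
have ex_spans : exists m, spans m.
  exists #|M|; apply/asboolP; exists enum_val; split=> [i|x Mx].
    exact: enum_valP.
  exists (fun i => (i == enum_rank_in Mx x)%:R).
  rewrite (bigD1 (enum_rank_in Mx x)) //= eqxx rmorph1 mul1r enum_rankK_in //.
  by rewrite big1 ?addr0 // => i /negPf->; rewrite rmorph0 mul0r.
case: (ex_minnP ex_spans) => m /asboolP[e [Me spanM]] min_m.
exists m, e; split=> // c ce0 j; apply/eqP/negPn/negP => cj0.
suff /min_m : spans m.-1 by rewrite leqNgt ltn_predL (leq_ltn_trans _ (ltn_ord j)).
apply/asboolP; exists (fun i => e (lift j i)); split=> // x Mx.
have [d ->] := spanM x Mx.
(* The relation gives [e j] as minus the sum of the [(c i / c j) e i] over [i] other than [j];
   substituting this into the expansion of [x] yields these coefficients. *)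
exists (fun i => d (lift j i) - d j / c j * c (lift j i)).
under [RHS]eq_bigr do rewrite rmorphB mulrBl rmorphM -mulrA.
rewrite sumrB -mulr_sumr [LHS](bigD1_ord j) //= addrC; congr (_ + _).
move/eqP: ce0; rewrite (bigD1_ord j) //= addrC addr_eq0 => /eqP ->.
by rewrite mulrN opprK mulrA -rmorphM divfK.
Qed.

(** * Polynomials modulo the products X_i X_j *)

Section QuadraticIdealTheory.

Variables (F : comNzRingType) (m : nat).

Lemma quadratic_ideal_gen (i j : 'I_m) : 'X_i * 'X_j \in @quadratic_ideal F m.
Proof.
apply/asboolP; exists (fun ij => (ij == (i, j))%:R).
rewrite (bigD1 (i, j)) //= eqxx mul1r big1 ?addr0 // => ij /negPf->.
by rewrite mul0r.
Qed.

(** Some variable X_i divides the monomial, and the quotient still has positive degree, so some X_j,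
    possibly with j = i, divides it in turn. *)
Lemma quadratic_ideal_monomial (k : 'X_{1..m}) :
  (1 < mdeg k)%N -> 'X_[k] \in @quadratic_ideal F m.
Proof.
have pos (l : 'X_{1..m}) : (0 < mdeg l)%N -> exists i, (U_(i) <= l)%MM.
  rewrite lt0n mdeg_eq0 => l0; apply: contrapT => no_i; case/negP: l0.
  apply/eqP/mnmP => i; rewrite mnm0E; apply/eqP/negPn/negP => li0.
  by apply: no_i; exists i; rewrite lep1mP.
move=> k_gt1; have [i le_ik] := pos k (ltnW k_gt1).
have [|j le_jk] := pos (k - U_(i))%MM.
  by move: k_gt1; rewrite -{1}(submK le_ik) mdegD mdeg1 addn1.
rewrite -(submK le_ik) mpolyXD -(submK le_jk) mpolyXD -mulrA.
by rewrite idealMr ?quadratic_ideal_gen.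
Qed.

Definition linear_part (p : {mpoly F[m]}) : {mpoly F[m]} :=
  (p@_0%MM)%:MP + \sum_i p@_U_(i) *: 'X_i.

(** Taking the linear part is F-linear, so monomials suffice. One of degree at least 2 lies in the
    ideal and has linear part 0; one of degree 0 or 1 is its own linear part. *)
Lemma linear_partP (p : {mpoly F[m]}) : p - linear_part p \in @quadratic_ideal F m.
Proof.
elim/mpolyind: p => [|c k p _ _ IHp].
  rewrite /linear_part mcoeff0 mpolyC0 big1 ?addr0 ?subrr ?rpred0 // => i _.
  by rewrite mcoeff0 scale0r.
have -> : linear_part (c *: 'X_[k] + p) = c *: linear_part 'X_[k] + linear_part p.
  rewrite /linear_part mcoeffD mcoeffZ mpolyCD mpolyCM mul_mpolyC scalerDr.
  rewrite addrACA; congr (_ + _); rewrite scaler_sumr -big_split /=.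
  by apply: eq_bigr => i _; rewrite mcoeffD mcoeffZ scalerDl scalerA.
rewrite opprD addrACA rpredD // -scalerBr -mul_mpolyC idealMr //.
have [k_gt1|] := ltnP 1 (mdeg k).
  rewrite /linear_part mcoeffX big1 => [|i _].
    case: eqP k_gt1 => [->|_ k_gt1]; first by rewrite mdeg0.
    by rewrite mpolyC0 addr0 subr0 quadratic_ideal_monomial.
  rewrite mcoeffX; case: eqP k_gt1 => [->|_ _]; first by rewrite mdeg1.
  by rewrite scale0r.
case: (posnP (mdeg k)) => [/eqP|k_gt0 k_le1].
  rewrite mdeg_eq0 => /eqP-> _; rewrite /linear_part mcoeffX eqxx mpolyC1.
  rewrite big1 ?addr0 ?mpolyX0 ?subrr ?rpred0 // => i _.
  by rewrite mcoeff1 mnm1_eq0 scale0r.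
have /mdeg1P[j /eqP ->] : mdeg k == 1%N by rewrite eqn_leq k_le1.
rewrite /linear_part mcoeffX mnm1_eq0 mpolyC0 add0r (bigD1 j) //=.
rewrite mcoeffX eqxx scale1r big1 ?addr0 ?subrr ?rpred0 // => i ne_ij.
by rewrite mcoeffX eq_mnm1 eq_sym (negPf ne_ij) scale0r.
Qed.

End QuadraticIdealTheory.

(** * Evaluation of polynomials at a basis of M *)

Lemma quadratic_quotient_iso (R : finComNzRingType) (M : {set R})
    (F : finFieldType) (iota : {rmorphism F -> R}) :
    local_ring M -> {in M &, forall x y, x * y = 0} ->
    (forall x, exists a, x - iota a \in M) ->
  exists m, ring_iso R (quadratic_quotient F m).
Proof.
move=> locM MM0 splitM; have [m [e [Me spanM free_e]]] := spanning_basis iota M.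
exists m; apply: (@first_isomorphism _ _ _ (mmap iota e)) => [x|p].
  have [a /spanM[c def_x]] := splitM x.
  exists (a%:MP + \sum_i c i *: 'X_i); rewrite /= mmapD mmapC raddf_sum /=.
  rewrite -[RHS](subrK (iota a)) addrC def_x; congr (_ + _).
  by apply: eq_bigr => i _; rewrite mmapZ mmapX mmap1U.
have ideal0 q : q \in @quadratic_ideal F m -> mmap iota e q = 0.
  case/asboolP=> c ->; rewrite raddf_sum big1 //= => -[i j] _.
  by rewrite !rmorphM /= !mmapX !mmap1U (MM0 (e i) (e j)) ?mulr0.
(* Conversely, if [p] evaluates to 0, so does its linear part, because their difference is in the
   ideal. It remains to show that all coefficients of the linear part vanish. *)
apply/idP/eqP => [|hp0]; first exact: ideal0.
have := ideal0 _ (linear_partP p); rewrite mmapB hp0 sub0r => /eqP.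
rewrite oppr_eq0 /linear_part mmapD mmapC raddf_sum /=.
under eq_bigr do rewrite mmapZ mmapX mmap1U.
move/eqP=> lin0.
(* The constant term maps to minus a combination of the [e i], hence into [M], whereas a nonzero
   element of [F] maps to a unit. *)
have p0 : p@_0 = 0.
  apply/eqP/negPn/negP => p0.
  have /(maximal_nonunit locM (iota (p@_0)^-1)) : iota p@_0 \in M.
    move/eqP: lin0; rewrite addr_eq0 => /eqP ->; rewrite -sub0r.
    rewrite (maximalB locM) ?(maximal0 locM) //.
    elim/big_ind: _ => [|x y|i _]; first exact: maximal0 locM.
      exact: maximalD.
    exact: maximalMl.
  by rewrite -rmorphM divff // rmorph1 eqxx.
move: lin0; rewrite p0 rmorph0 add0r => /free_e pU.
have := linear_partP p; rewrite /linear_part p0 mpolyC0 add0r big1 ?subr0 //.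
by move=> i _; rewrite pU scale0r.
Qed.

Theorem theorem4p2 (R : finComNzRingType) (M : {set R}) (p n : nat)
  (hp : prime p) (hchar : has_characteristic R (p ^ n)%N)
  (hloc : local_ring M)
  (hconn : aut_connected (M :\ 0%R)) :
  ring_iso R 'Z_4 \/
  exists (F : finFieldType) (m : nat), ring_iso R (quadratic_quotient F m).
Proof.
have [p0|p_neq0] := eqVneq (p%:R : R) 0; last first.
  by left; apply: Z4_of_nonzero_char hp hchar hloc hconn p_neq0.
have MM0 := maximal_square0 hloc hconn.
have charR : p \in [pchar R] by rewrite inE hp p0 eqxx.
have [F [iota splitM]] := coefficient_field hloc MM0 charR.
by right; exists F; apply: quadratic_quotient_iso hloc MM0 splitM.
Qed.
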